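(* Let $m$ be a finite positive measure on a measurable space $(E,\mathcal{B})$ and $(P_t)_{t\ge0}$ a strongly continuous semigroup of Markovian operators on $L^p(m)$ for some $p\ge1$, with resolvent $R_\alpha f=\int_0^\infty e^{-\alpha t}P_tf\,dt$. Assume $R_\alpha$ is defined on $L^p(m)$ for all $\alpha>0$ and that $(\alpha R_\alpha)_{\alpha>0}$ is uniformly bounded in operator norm on $L^p(m)$. Then $m$ is resolvent almost invariant, and hence there exists a nonzero positive finite invariant measure $\nu=\rho\cdot m$ for $(P_t)_{t\ge0}$. Moreover, if $p>1$ then $\rho$ can be chosen in $L^q_+(m)$, where $\frac1p+\frac1q=1$.
   Context: A Markovian operator is a positivity preserving linear operator $T$ with $T1=1$. $m$ is resolvent almost invariant if there exist $\delta\in[0,1)$ and $\phi:\mathcal{B}\to[0,\infty)$ with $\lim_{m(A)\to0}\phi(A)=0$ such that $m(\alpha R_\alpha1_A)\le\phi(A)+\delta m(E)$ for all $A\in\mathcal{B}$ and $\alpha>0$. A measure $\nu$ is invariant if $\int P_tf\,d\nu=\int f\,d\nu$ for all $t>0$ and $f\in L^\infty(m)$. *)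

(* Defs.v *)
From HB Require Import structures.
From mathcomp Require Import all_boot all_order all_algebra.
From mathcomp Require Import all_classical all_reals all_analysis.
Set Implicit Arguments. Unset Strict Implicit. Unset Printing Implicit Defensive.
Import Order.TTheory GRing.Theory Num.Theory.
Import numFieldNormedType.Exports.
Local Open Scope classical_set_scope.
Local Open Scope ring_scope.

(* Operators act on real-valued functions; they are only constrained on
   L^p functions and modulo m-a.e. equality (i.e. they are operators on
   the classes of L^p(m)). *)
Definition op (T : Type) (R : realType) := (T -> R) -> (T -> R).

Section defs.
Context (d : measure_display) (T : measurableType d) (R : realType).
Variable m : {finite_measure set T -> \bar R}.

Definition inLp (p : R) (f : T -> R) : Prop :=
  measurable_fun setT f /\ (Lnorm m p%:E (EFin \o f) < +oo)%E.

Definition normp (p : R) (f : T -> R) : R := fine (Lnorm m p%:E (EFin \o f)).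

(* bounded measurable functions: representatives of the classes of L^oo(m) *)
Definition bounded_meas (f : T -> R) : Prop :=
  measurable_fun setT f /\ exists C : R, forall x, `|f x| <= C.

Definition markovian_Lp (p : R) (P : op T R) : Prop :=
  (forall f, inLp p f -> inLp p (P f)) /\
  [/\ (forall f g, inLp p f -> inLp p g ->
         {ae m, forall x, f x = g x} -> {ae m, forall x, P f x = P g x}),
      (forall (a : R) f g, inLp p f -> inLp p g ->
         {ae m, forall x, P (fun y => a * f y + g y) x = a * P f x + P g x}),
      (forall f, inLp p f -> {ae m, forall x, 0 <= f x} ->
         {ae m, forall x, 0 <= P f x}),
      {ae m, forall x, P (cst 1) x = 1} &
      (exists C : R, forall f, inLp p f -> normp p (P f) <= C * normp p f)].

Definition C0_markov_semigroup (p : R) (P : R -> op T R) : Prop :=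
  [/\ (forall t, 0 <= t -> markovian_Lp p (P t)),
      (forall f, inLp p f -> {ae m, forall x, P 0 f x = f x}),
      (forall s t f, 0 <= s -> 0 <= t -> inLp p f ->
         {ae m, forall x, P (s + t) f x = P s (P t f) x}) &
      (forall f, inLp p f ->
         (fun t => normp p (fun x => P t f x - f x)) @ 0^'+ --> 0)].

(* Ra is the resolvent R_alpha f = \int_0^oo e^{-alpha t} P_t f dt, defined on
   all of L^p(m) for every alpha > 0, the integral being the L^p-valued
   Bochner integral: the integrand is Bochner integrable
   (\int_0^oo e^{-alpha t} ||P_t f||_p dt < oo; strong measurability follows
   from strong continuity) and its value R_alpha f in L^p(m) is
   characterized by duality against the bounded measurable functions
   (which separate the points of L^p(m), m being finite). *)
Definition is_resolvent (p : R) (P : R -> op T R) (Ra : R -> op T R) : Prop :=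
  forall alpha : R, 0 < alpha -> forall f, inLp p f ->
  [/\ inLp p (Ra alpha f),
      (lebesgue_measure).-integrable `[0%R, +oo[
         (fun t => (expR (- (alpha * t)) * normp p (P t f))%:E) &
      forall g, bounded_meas g ->
        (\int[m]_x (g x * Ra alpha f x)%:E =
         \int[lebesgue_measure]_(t in `[0%R, +oo[)
            (expR (- (alpha * t)) * fine (\int[m]_x (g x * P t f x)%:E))%:E)%E].

Definition unif_bounded_resolvent (p : R) (Ra : R -> op T R) : Prop :=
  exists M : R, forall alpha : R, 0 < alpha -> forall f, inLp p f ->
    normp p (fun x => alpha * Ra alpha f x) <= M * normp p f.

Definition resolvent_almost_invariant (Ra : R -> op T R) : Prop :=
  exists (delta : R) (phi : set T -> R),
  [/\ 0 <= delta, delta < 1,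
      (forall A, 0 <= phi A),
      (forall eps : R, 0 < eps -> exists eta : R, 0 < eta /\
         forall A, measurable A -> (m A < eta%:E)%E -> phi A < eps) &
      (forall A, measurable A -> forall alpha : R, 0 < alpha ->
         (\int[m]_x (alpha * Ra alpha (\1_A) x)%:E
            <= (phi A)%:E + delta%:E * m setT)%E)].

Definition invariant_density (P : R -> op T R) (rho : T -> R) : Prop :=
  [/\ measurable_fun setT rho,
      (forall x, 0 <= rho x),
      (0 < \int[m]_x (rho x)%:E)%E,
      (\int[m]_x (rho x)%:E < +oo)%E &
      (forall t : R, 0 < t -> forall f, bounded_meas f ->
         (\int[m]_x (P t f x * rho x)%:E = \int[m]_x (f x * rho x)%:E)%E)].

End defs.

(* Main.v *)
Require Import Defs.
From HB Require Import structures.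
From mathcomp Require Import all_boot all_order all_algebra finmap.
From mathcomp Require Import all_classical all_reals all_analysis.
From mathcomp Require Import measurable_realfun ring lra.
Set Implicit Arguments.
Unset Strict Implicit.
Unset Printing Implicit Defensive.
Import Order.TTheory GRing.Theory Num.Theory.
Import numFieldNormedType.Exports.
Local Open Scope classical_set_scope.
Local Open Scope ring_scope.

(** For bounded [f >= 0], [m (a R_a f)] is the Abel mean
    [a \int_0^oo e^(-a t) m (P_t f) dt], and Hoelder's inequality together with
    the uniform bound on [a R_a] gives [m (a R_a f) <= C ||f||_p] with [C]
    independent of [a]; for indicators this is resolvent almost invariance with
    [delta = 0].  Along an ultrafilter refining [a -> 0+] the Abel means
    converge to a positive linear functional [L] with the same bound; it is therefore
    given by a density [rho] (Radon-Nikodym).  Since the Abel means of [P_s f]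
    and [f] differ by [O(a)], [L] is invariant.  For [p > 1] the bound
    [L f <= C ||f||_p], tested on [min(rho, n)^(q - 1)], gives
    [||rho||_q <= C]. *)

(** * Abel means *)

Section abel_means.
Context {R : realType}.
Implicit Types (a c s t K : R) (F G : R -> R).

(** The mean of [F] under the exponential law of rate [a], equivalently [a] times the Laplace
    transform of [F] at [a]. The integral is real valued, so linearity and monotonicity need
    integrability each time. *)
Definition abel a F : R :=
  \int[lebesgue_measure]_(t in `[0, +oo[) (a * expR (- (a * t)) * F t).

(** The pushforward gives every half-open interval its length, and Lebesgue measure is the only
    measure that does. *)
Lemma lebesgue_measure_shift s (A : set R) : measurable A ->
  pushforward lebesgue_measure ((fun t => t + s) : _ -> measurableTypeR R) A =
  lebesgue_measure A.
Proof.
move=> mA.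
have ms : measurable_fun setT
    ((fun t => t + s) : measurableTypeR R -> measurableTypeR R).
  exact: measurable_funD.
pose phi : {mfun measurableTypeR R >-> measurableTypeR R} :=
  HB.pack ((fun t => t + s) : measurableTypeR R -> measurableTypeR R)
    (isMeasurableFun.Build _ _ _ _ _ ms).
apply/esym; rewrite -[LHS]/(lebesgue_measure A).
apply: (@lebesgue_measure_unique _ (pushforward lebesgue_measure phi)) => //.
move=> _ [[a b] _ <-]; rewrite /pushforward/=.
rewrite [X in _ = lebesgue_measure X](_ : _ = `]a - s, b - s]%classic);
  last first.
  by apply/seteqP; split => t /=; rewrite !in_itv/= ltrBlDr lerBrDr.
rewrite !lebesgue_measure_itv/= !lte_fin ltrD2r; case: ifP => // _.
by rewrite -!EFinB; congr EFin; ring.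
Qed.

(** Change of variables: Lebesgue measure is its own pushforward under the shift by [s], and the
    preimage of [[s, +oo[] is [[0, +oo[]. *)
Lemma ge0_integral_shift s (f : R -> \bar R) :
  measurable_fun `[s, +oo[ f -> (forall t, s <= t -> (0 <= f t)%E) ->
  (\int[lebesgue_measure]_(t in `[s, +oo[) f t =
   \int[lebesgue_measure]_(t in `[0%R, +oo[) f (t + s)%R)%E.
Proof.
move=> mf f0.
pose phi : measurableTypeR R -> measurableTypeR R := fun t => t + s.
have mphi : measurable_fun setT phi by exact: measurable_funD.
transitivity (\int[pushforward lebesgue_measure phi]_(t in `[s, +oo[) f t)%E.
  apply: eq_measure_integral => //= A mA AS.
  exact/esym/lebesgue_measure_shift.
rewrite (ge0_integral_pushforward mphi)//=; last first.
  by move=> t; rewrite inE/= in_itv/= andbT => /f0.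
congr (integral _ _ _); apply/seteqP; split => t /=;
  by rewrite !in_itv/= !andbT /phi lerDr.
Qed.

Lemma integral_exp_weight a : 0 < a ->
  (\int[lebesgue_measure]_(t in `[0%R, +oo[) (a * expR (- (a * t)))%:E = 1)%E.
Proof.
move=> a0; rewrite -(integral_exponential_pdf a0) [LHS]integral_mkcond.
apply: eq_integral => t _; rewrite /exponential_pdf !patchE.
by case: ifP => // _; rewrite mulNr.
Qed.

Lemma measurable_exp_weight a (D : set R) :
  measurable_fun D (fun t => a * expR (- (a * t))).
Proof.
apply: measurable_funTS; apply: continuous_measurable_fun => t.
apply: cvgM; first exact: cvg_cst.
apply: continuous_comp; last exact: continuous_expR.
by apply: cvgN; apply: cvgM; [exact: cvg_cst|exact: cvg_id].
Qed.

(** The integrand is dominated by [K] times the exponential weight, which has total mass 1. *)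
Lemma abel_integrable a F K : 0 < a -> measurable_fun `[(0 : R), +oo[ F ->
  (forall t, 0 <= t -> `|F t| <= K) ->
  lebesgue_measure.-integrable `[0%R, +oo[
    (EFin \o (fun t => a * expR (- (a * t)) * F t)).
Proof.
move=> a0 mF FK.
have K0 : 0 <= K by rewrite (le_trans _ (FK 0 _)).
have iw : lebesgue_measure.-integrable `[0%R, +oo[
    (fun t : R => (a * expR (- (a * t)))%:E).
  apply/integrableP; split.
    by apply/measurable_EFinP; exact: measurable_exp_weight.
  under eq_integral do rewrite gee0_abs ?lee_fin ?mulr_ge0 ?expR_ge0 ?ltW//.
  by rewrite integral_exp_weight// ltry.
refine (le_integrable _ _ _ (integrableZl _ K iw)) => //.
- apply/measurable_EFinP; apply: measurable_funM => //.
  exact: measurable_exp_weight.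
- move=> t /=; rewrite in_itv/= andbT => t0.
  rewrite lee_fin !normrM mulrC (ger0_norm K0).
  by rewrite ler_wpM2r// ?mulr_ge0 ?FK.
Qed.

Lemma abelDZ a c F G K K' : 0 < a ->
  measurable_fun `[(0 : R), +oo[ F -> measurable_fun `[(0 : R), +oo[ G ->
  (forall t, 0 <= t -> `|F t| <= K) -> (forall t, 0 <= t -> `|G t| <= K') ->
  abel a (fun t => c * F t + G t) = c * abel a F + abel a G.
Proof.
move=> a0 mF mG FK GK; rewrite /abel.
have iF := abel_integrable a0 mF FK; have iG := abel_integrable a0 mG GK.
rewrite -RintegralZl// -RintegralD//; last exact: (integrableZl _ c iF).
by apply: eq_Rintegral => t _; ring.
Qed.

Lemma eq_abel a F G : (forall t, 0 <= t -> F t = G t) -> abel a F = abel a G.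
Proof.
move=> FG; apply: eq_Rintegral => t; rewrite inE/= in_itv/= andbT => t0.
by rewrite FG.
Qed.

Lemma abel_cst a c : 0 < a -> abel a (fun=> c) = c.
Proof.
move=> a0.
have i1 : lebesgue_measure.-integrable `[0%R, +oo[
    (EFin \o (fun t => a * expR (- (a * t)) * 1)).
  by apply: (@abel_integrable _ (fun=> 1) 1) => // t _; rewrite normr1.
transitivity (\int[lebesgue_measure]_(t in `[0, +oo[)
    (c * (a * expR (- (a * t)) * 1))).
  by apply: eq_Rintegral => t _; ring.
rewrite RintegralZl// /Rintegral.
by under eq_integral do rewrite mulr1; rewrite integral_exp_weight//= mulr1.
Qed.

Lemma abel_ge0 a F : 0 < a -> (forall t, 0 <= t -> 0 <= F t) -> 0 <= abel a F.
Proof.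
move=> a0 F0; apply: Rintegral_ge0 => t /=; rewrite in_itv/= andbT => t0.
by rewrite !mulr_ge0 ?expR_ge0 ?F0 ?(ltW a0).
Qed.

Lemma abel_le a F K : 0 < a -> measurable_fun `[(0 : R), +oo[ F ->
  (forall t, 0 <= t -> 0 <= F t <= K) -> abel a F <= K.
Proof.
move=> a0 mF FK; rewrite -[leRHS](@abel_cst a)//; apply: le_Rintegral => //.
- apply: (@abel_integrable _ _ K) => // t /FK/andP[F0 ?].
  by rewrite ger0_norm.
- by apply: (@abel_integrable _ _ `|K|) => // t _.
- move=> t /=; rewrite in_itv/= andbT => /FK/andP[_ FtK].
  by rewrite ler_wpM2l// mulr_ge0 ?expR_ge0// ltW.
Qed.

(** Split the half-line at [s]. Translated back to 0, the tail is exactly [expR (- (a * s))] times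
    the Abel mean of the shifted function. On [[0, s[] the weight is at most [a], so this piece lies
    between 0 and [a * K * s]. *)
Lemma abel_shift a F K s : 0 < a -> 0 <= s ->
  measurable_fun `[(0 : R), +oo[ F ->
  (forall t, 0 <= t -> 0 <= F t <= K) ->
  expR (- (a * s)) * abel a (fun t => F (t + s)) <= abel a F
    <= a * K * s + expR (- (a * s)) * abel a (fun t => F (t + s)).
Proof.
move=> a0 s0 mF FK.
have K0 : 0 <= K by have /andP[] := FK _ (lexx _); exact: le_trans.
have FK' t : 0 <= t -> `|F t| <= K by move=> /FK/andP[F0 ?]; rewrite ger0_norm.
have mFs : measurable_fun `[(0 : R), +oo[ (fun t => F (t + s)).
  apply: (measurable_comp _ _ mF) => //.
    by move=> u [t /=]; rewrite !in_itv/= !andbT => t0 <-; exact: addr_ge0.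
  exact: measurable_funD.
have iFs : lebesgue_measure.-integrable `[0%R, +oo[
    (EFin \o (fun t => a * expR (- (a * t)) * F (t + s))).
  by apply: (@abel_integrable _ _ K) => // t t0; rewrite FK' ?addr_ge0.
have iF := abel_integrable a0 mF FK'.
have split0s : `[0, +oo[%classic = `[0, s[ `|` `[s, +oo[ :> set R.
  by rewrite -itv_bndbnd_setU// bnd_simp.
have -> : abel a F =
    \int[lebesgue_measure]_(t in `[0, s[) (a * expR (- (a * t)) * F t)
    + expR (- (a * s)) * abel a (fun t => F (t + s)).
  rewrite /abel {1}split0s Rintegral_setU//; last 2 first.
    by rewrite -split0s.
    apply/disj_setPS => t [] /=; rewrite !in_itv/= => /andP[_ ts] /andP[st _].
    by move: (lt_le_trans ts st); rewrite ltxx.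
  congr (_ + _); rewrite -RintegralZl//; congr fine.
  rewrite ge0_integral_shift; last 2 first.
  - apply/measurable_EFinP/measurable_funM; first exact: measurable_exp_weight.
    by apply: measurable_funS mF => // t; apply: subset_itvr; rewrite bnd_simp.
  - move=> t st; have /FK/andP[F0 _] := le_trans s0 st.
    by rewrite lee_fin !mulr_ge0 ?expR_ge0// ltW.
  apply: eq_integral => t _; congr EFin; rewrite mulrDr opprD expRD; ring.
have i0s : lebesgue_measure.-integrable `[0%R, s[
    (EFin \o (fun t => a * expR (- (a * t)) * F t)).
  by apply: integrableS iF => //; rewrite split0s; exact: subsetUl.
rewrite lerDr lerD2r; apply/andP; split.
  apply: Rintegral_ge0 => t /=; rewrite in_itv/= => /andP[/FK/andP[F0 _] _].
  by rewrite !mulr_ge0 ?expR_ge0// ltW.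
have m0s : lebesgue_measure (`[0, s[%classic : set R) = s%:E.
  rewrite lebesgue_measure_itv/= lte_fin.
  by case: ltgtP s0 => // [s0|<-]; rewrite ?sube0 ?oppr0.
rewrite (_ : a * K * s = \int[lebesgue_measure]_(t in `[0, s[) (a * K));
  last first.
  by rewrite Rintegral_cst//= m0s.
apply: le_Rintegral => //.
  apply/integrableP; split; first exact: measurable_cst.
  rewrite /= integral_cst//= lebesgue_measure_itv/= lte_fin.
  by case: ifP => _; rewrite ?mule0 -?EFinB -?EFinM ltry.
move=> t /=; rewrite in_itv/= => /andP[t0 _].
have /andP[F0 FtK] := FK _ t0; rewrite -mulrA ler_wpM2l ?(ltW a0)//.
rewrite -[leRHS]mul1r ler_pM ?expR_ge0// -expR0 ler_expR oppr_le0.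
by rewrite mulr_ge0 ?(ltW a0).
Qed.

End abel_means.

(** * Limits along ultrafilters, and measurability from right continuity *)

Section real_functions.
Context {R : realType}.

(** By compactness of [[a, b]] the image ultrafilter has a cluster point [p]. It converges to [p]:
    otherwise it would contain the complement of some neighbourhood of [p], and that complement
    would have to meet the neighbourhood. *)
Lemma ultra_bounded_cvg (I : Type) (U : set_system I) (u : I -> R) (a b : R) :
  UltraFilter U -> (\forall i \near U, a <= u i <= b) -> cvg (u i @[i --> U]).
Proof.
move=> UU uab; have UP := @ultra_proper _ _ UU.
have : (u @ U) `[a, b]%classic by apply: filterS uab => i; rewrite /= in_itv.
move=> /(@segment_compact R a b (u @ U) _)[p [_ clp]].
apply/cvg_ex; exists p => V Vp; rewrite /nbhs/=.
have [//|UV] := in_ultra_setVsetC (u @^-1` V) UU.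
by have [x [nVx Vx]] := clp (~` V) V UV Vp.
Qed.

(** [F] is the pointwise limit of step functions, obtained by evaluating it at grid points that
    approach [t] from the right. *)
Lemma right_continuous_measurable_fun (F : R -> R) :
  (forall t, 0 <= t -> F x @[x --> t^'+] --> F t) ->
  measurable_fun `[(0 : R), +oo[ F.
Proof.
(* [u n t] is the right end of the cell of mesh [1 / n.+1] that contains [t]. It is strictly above
   [t], as the filter [t^'+] requires. *)
move=> Frc; pose u n (t : R) : R := (Num.truncn (t * n.+1%:R)).+1%:R / n.+1%:R.
have uP n t : 0 <= t -> t < u n t <= t + n.+1%:R^-1.
  move=> t0; rewrite /u ltr_pdivlMr// ler_pdivrMr// mulrDl mulVf//.
  have /Num.Theory.truncn_itv/andP[h1 ->/=] : 0 <= t * n.+1%:R.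
    by rewrite mulr_ge0.
  by rewrite -natr1 lerD2r.
apply: (@measurable_fun_cvg _ _ _ _ (fun n => F \o u n)) => [n|t].
  move=> mD Y mY.
  (* [F \o u n] is constant on each cell, so the preimage of [Y] is a countable union of cells. *)
  rewrite [X in measurable X](_ : _ =
    \bigcup_(k in [set k | Y (F (k.+1%:R / n.+1%:R))])
    `[k%:R / n.+1%:R, k.+1%:R / n.+1%:R[%classic).
    by apply: bigcup_measurable => k _.
  apply/seteqP; split => t /=.
    rewrite in_itv/= andbT => -[t0 Yt].
    exists (Num.truncn (t * n.+1%:R)) => //=.
    rewrite in_itv/= ler_pdivrMr// ltr_pdivlMr//.
    by apply: truncn_itv; rewrite mulr_ge0.
  move=> [k /= Yk]; rewrite !in_itv/= ler_pdivrMr// ltr_pdivlMr// => tk.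
  have /andP[kt _] := tk.
  have t0 : 0 <= t by rewrite -(@pmulr_lge0 _ n.+1%:R)// (le_trans _ kt).
  by rewrite t0 /u (truncn_def tk).
rewrite /= in_itv/= andbT => t0.
have ucvg : u n t @[n --> \oo] --> t^'+.
  move=> A /= [e /= e0 eA]; have := near_infty_natSinv_lt (PosNum e0).
  apply: filterS => n /= ne; have /andP[tu ut] := uP n t t0.
  apply: eA => //=; rewrite ltr0_norm ?subr_lt0// opprB ltrBlDl.
  by rewrite (le_lt_trans ut)// ltrD2l.
exact: (cvg_comp _ _ ucvg (Frc t t0)).
Qed.

End real_functions.

(** * Density of an absolutely continuous functional *)

Section functional_density.
Context d (T : measurableType d) (R : realType).
Variable m : {finite_measure set T -> \bar R}.
Implicit Types (f g : T -> R) (A B : set T).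

(** The cone of test functions: it contains the indicators, and positivity keeps all integrals over
    it free of sign conditions. The bounds hold everywhere, not merely almost everywhere. *)
Definition nnbounded f :=
  measurable_fun setT f /\ exists K : R, forall x, 0 <= f x <= K.

Lemma nnbounded_cst (c : R) : 0 <= c -> nnbounded (cst c).
Proof.
by move=> c0; split; [exact: measurable_cst|exists c => x /=; rewrite c0 lexx].
Qed.

Lemma nnbounded_indic A : measurable A -> nnbounded \1_A.
Proof.
move=> mA; split; first exact: measurable_indic.
by exists 1 => x; rewrite indicE; case: (_ \in _); rewrite /= ?lexx ?ler01.
Qed.

Lemma nnboundedDZ (c : R) f g : 0 <= c -> nnbounded f -> nnbounded g ->
  nnbounded (fun x => c * f x + g x).
Proof.
move=> c0 [mf [K fK]] [mg [L gL]]; split.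
  by apply: measurable_funD => //; apply: measurable_funM.
exists (c * K + L) => x; have /andP[f0 fKx] := fK x; have /andP[g0 gLx] := gL x.
by rewrite addr_ge0 ?mulr_ge0//= lerD// ler_wpM2l.
Qed.

Lemma nnbounded_sum n (c : 'I_n -> R) (A : 'I_n -> set T) :
  (forall i, 0 <= c i) -> (forall i, measurable (A i)) ->
  nnbounded (fun x => \sum_(i < n) c i * \1_(A i) x).
Proof.
elim: n c A => [|n ih] c A c0 mA.
  rewrite (_ : (fun _ => _) = cst 0); first exact: nnbounded_cst.
  by apply/funext => x; rewrite big_ord0.
rewrite (_ : (fun _ => _) = fun x => c ord0 * \1_(A ord0) x +
    \sum_(i < n) c (lift ord0 i) * \1_(A (lift ord0 i)) x).
  by apply: nnboundedDZ => //; [exact: nnbounded_indic|exact: ih].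
by apply/funext => x; rewrite big_ord_recl.
Qed.

Variable L : (T -> R) -> R.
Hypothesis LDZ : forall (c : R) f g, 0 <= c -> nnbounded f -> nnbounded g ->
  L (fun x => c * f x + g x) = c * L f + L g.
Hypothesis L_ge0 : forall f, nnbounded f -> 0 <= L f.
Hypothesis L_ac : forall e : R, 0 < e -> exists eta : R, 0 < eta /\
  forall A, measurable A -> (m A < eta%:E)%E -> L \1_A < e.

Lemma functional0 : L (cst 0) = 0.
Proof.
have := @LDZ 1 _ _ ler01 (nnbounded_cst (lexx 0)) (nnbounded_cst (lexx 0)).
rewrite (_ : (fun _ => _) = cst 0); last first.
  by apply/funext => x /=; rewrite mulr0 addr0.
by rewrite mul1r => /esym/eqP; rewrite -subr_eq0 addrK => /eqP.
Qed.

Lemma functional_sum n (c : 'I_n -> R) (A : 'I_n -> set T) :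
  (forall i, 0 <= c i) -> (forall i, measurable (A i)) ->
  L (fun x => \sum_(i < n) c i * \1_(A i) x) = \sum_(i < n) c i * L \1_(A i).
Proof.
elim: n c A => [|n ih] c A c0 mA.
  rewrite (_ : (fun _ => _) = cst 0) ?functional0 ?big_ord0//.
  by apply/funext => x; rewrite big_ord0.
rewrite (_ : (fun _ => _) = fun x => c ord0 * \1_(A ord0) x +
    \sum_(i < n) c (lift ord0 i) * \1_(A (lift ord0 i)) x); last first.
  by apply/funext => x; rewrite big_ord_recl.
rewrite LDZ ?big_ord_recl ?ih//; first exact: nnbounded_indic.
exact: nnbounded_sum.
Qed.

Lemma functionalD f g : nnbounded f -> nnbounded g ->
  L (fun x => f x + g x) = L f + L g.
Proof.
move=> bf bg; have := LDZ ler01 bf bg; rewrite mul1r => <-.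
by congr L; apply/funext => x; rewrite mul1r.
Qed.

(** The difference [g - f] is again in the cone, where [L] is nonnegative. *)
Lemma le_functional f g : nnbounded f -> nnbounded g ->
  (forall x, f x <= g x) -> L f <= L g.
Proof.
move=> bf bg fg.
have bgf : nnbounded (fun x => g x - f x).
  split; first by apply: measurable_funB; [exact: bg.1|exact: bf.1].
  have [_ [K gK]] := bg; have [_ [K' fK']] := bf; exists K => x.
  rewrite subr_ge0 fg/= lerBlDr; have /andP[_ /le_trans->//] := gK x.
  by rewrite lerDl; have /andP[] := fK' x.
have -> : L g = L (fun x => f x + (g x - f x)).
  by congr L; apply/funext => x; rewrite addrC subrK.
by rewrite functionalD// lerDl L_ge0.
Qed.

(** The value 0 off the measurable sets makes [nu] nonnegative on every set, where [L_ge0] alone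
    says nothing. *)
Let nu A : \bar R := if `[< measurable A >] then (L \1_A)%:E else 0%E.

Let nuE A : measurable A -> nu A = (L \1_A)%:E.
Proof. by move=> mA; rewrite /nu asboolT. Qed.

Let nu0 : nu set0 = 0%E.
Proof. by rewrite nuE// indic0 functional0. Qed.

Let nu_ge0 A : (0 <= nu A)%E.
Proof.
rewrite /nu; case: asboolP => // mA.
by rewrite lee_fin L_ge0//; exact: nnbounded_indic.
Qed.

(** Finite additivity comes from additivity of [L]. The remainders [U \ S n] decrease to the empty
    set, so their [m]-measure tends to 0 because [m] is finite, and [L_ac] makes their [L]-value
    tend to 0. *)
Let nu_sigma_additive : semi_sigma_additive nu.
Proof.
move=> F mF tF mU; pose U := \bigcup_n F n.
pose S n := \big[setU/set0]_(i < n) F i.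
have mS n : measurable (S n) by exact: bigsetU_measurable.
have nuS n : (\sum_(0 <= i < n) nu (F i) = (L \1_(S n))%:E)%E.
  elim: n => [|n ih]; first by rewrite big_geq// /S big_ord0 indic0 functional0.
  rewrite big_nat_recr//= ih nuE// -EFinD; congr EFin.
  rewrite -functionalD; [|exact: nnbounded_indic..].
  congr L; apply/funext => x; rewrite /S big_ord_recr/= !indicE in_setU.
  have [xS|//] := boolP (x \in \big[setU/set0]_(i < n) F i); last first.
    by rewrite add0r.
  rewrite (_ : x \in F n = false) ?addr0//.
  apply/negbTE/negP; rewrite inE => xFn.
  move: xS; rewrite inE -bigcup_mkord => -[i /= ilt xFi].
  have ni : i = n by apply: tF => //; exists x.
  by rewrite ni ltnn in ilt.
rewrite nuE//; under eq_fun do rewrite nuS.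
apply/fine_cvgP; split; first exact: nearW.
apply/cvgrPdist_lt => e e0; have [eta [eta0 etaP]] := L_ac e0.
have cD : m (U `\` S n) @[n --> \oo] --> 0%E.
  rewrite -(measure0 m) (_ : set0 = \bigcap_n (U `\` S n)); last first.
    apply/seteqP; split => // x Ux; have [[n _ Fnx] _] := Ux 0%N Logic.I.
    have [_] := Ux n.+1 Logic.I; apply; rewrite /S -bigcup_mkord.
    by exists n => /=.
  apply: nonincreasing_cvg_mu.
  - by rewrite ltey_eq fin_num_measure//; exact: measurableD.
  - by move=> i; exact: measurableD.
  - by apply: bigcap_measurable => // i _; exact: measurableD.
  - move=> n k nk; apply/subsetPset; apply: setDS; rewrite /S -!bigcup_mkord.
    apply: bigcup_sub => i /= ilt x Fix; exists i => //=.
    exact: leq_trans nk.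
have : \forall n \near \oo, (m (U `\` S n) < eta%:E)%E.
  have /fine_cvgP[_ /cvgrPdist_lt/(_ _ eta0)] := cD.
  apply: filterS => n /=; rewrite sub0r normrN => mn.
  rewrite -(@fineK _ (m _)) ?fin_num_measure//; last exact: measurableD.
  by rewrite lte_fin (le_lt_trans (ler_norm _)).
apply: filterS => n mn /=.
have SU : S n `<=` U.
  by rewrite /S -bigcup_mkord; apply: bigcup_sub => i _; exact: bigcup_sup.
have mD : measurable (U `\` S n) by exact: measurableD.
have -> : L \1_U = L \1_(S n) + L \1_(U `\` S n).
  rewrite -functionalD; [|exact: nnbounded_indic..].
  congr L; apply/funext => x; rewrite !indicE in_setD.
  have [xS|] := boolP (x \in S n); last by rewrite andbT add0r.
  by rewrite andbF addr0 (mem_set (SU _ (set_mem xS))).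
rewrite addrC addKr ger0_norm ?L_ge0//; last exact: nnbounded_indic.
exact: etaP.
Qed.

Let nu_fin_num : fin_num_fun nu.
Proof. by move=> A mA; rewrite nuE. Qed.

Lemma functional_measure : exists nu : {finite_measure set T -> \bar R},
  forall A, measurable A -> nu A = (L \1_A)%:E.
Proof.
pose nuM : {measure set T -> \bar R} := HB.pack nu
  (isMeasure.Build _ _ _ nu nu0 nu_ge0 nu_sigma_additive).
pose nuF : {finite_measure set T -> \bar R} :=
  HB.pack_for (FiniteMeasure.type T R) (Measure.sort nuM)
    (Measure_isFinite.Build _ _ _ nuM nu_fin_num).
by exists nuF => A mA; exact: nuE.
Qed.

Import HBNNSimple.

(** The measure given by [L] on indicators is absolutely continuous with respect to [m], and [rho]
    is its Radon-Nikodym derivative. It remains to see that [L] is integration against that measure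
    on the whole cone. *)
Lemma functional_density : exists rho : T -> R,
  [/\ measurable_fun setT rho, forall x, 0 <= rho x,
      m.-integrable setT (EFin \o rho) &
      forall f, nnbounded f -> (\int[m]_x (f x * rho x)%:E = (L f)%:E)%E].
Proof.
have [mu muE] := functional_measure.
have mum : mu `<< m.
  apply/null_content_dominatesP => A mA mA0 /=; rewrite muE//.
  congr EFin; apply/eqP; rewrite eq_le L_ge0 ?andbT; last first.
    exact: nnbounded_indic.
  apply/ler_addgt0Pr => e e0; rewrite add0r; have [eta [eta0 etaP]] := L_ac e0.
  by apply/ltW/etaP => //; rewrite mA0 lte_fin.
(* For simple [h <= f] the integral of [h] equals [L h], which is at most [L f] by monotonicity;
   then take the supremum over [h]. *)
have int_le f : nnbounded f -> (\int[mu]_x (f x)%:E <= (L f)%:E)%E.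
  move=> bf; have [mf [K fK]] := bf.
  rewrite ge0_integralTE; last first.
    by move=> x; rewrite lee_fin; have /andP[] := fK x.
  apply: ge_ereal_sup => _ [h /= hf <-].
  have -> : sintegral mu h = (\int[mu]_x (h x)%:E)%E.
    by rewrite integral_nnsfun// patch_setT.
  pose s := fset_set (range h).
  have s0 i : 0 <= s`_i.
    (* Past the end of [s] the default value is 0. *)
    have [si|si] := ltnP i (size s); last by rewrite nth_default.
    have : s`_i \in s by rewrite mem_nth.
    by rewrite in_fset_set ?inE// => -[x _ <-].
  have mhs i : measurable (h @^-1` [set s`_i]) by [].
  rewrite (_ : (fun x => (h x)%:E) = fun x =>
      (\sum_(i < #|` s|) (s`_i)%:E * (\1_(h @^-1` [set s`_i]) x)%:E)%E);
    last first.
    by apply/funext => x; rewrite (fimfunEord h) -sumEFin.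
  rewrite ge0_integral_sum//; last 2 first.
  - by move=> i; apply: measurable_funeM; exact/measurable_EFinP.
  - by move=> i x _; rewrite lee_fin mulr_ge0.
  rewrite (eq_bigr (fun i : 'I_#|` s| =>
    (s`_i * L \1_(h @^-1` [set s`_i]))%:E)).
    rewrite sumEFin lee_fin -functional_sum//.
    apply: le_functional => //; first exact: nnbounded_sum.
    by move=> x; have := hf x; rewrite (fimfunEord h) lee_fin.
  move=> i _; rewrite ge0_integralZl ?lee_fin//; last exact/measurable_EFinP.
  by rewrite integral_indic// setIT EFinM; congr (_ * _)%E; exact: muE.
(* Equality needs no convergence theorem: [int_le] holds for [f] and for [|K| - f], and the two
   sides have the same sum [|K| * L \1_setT], so neither inequality can be strict. *)
have int_eq f : nnbounded f -> (\int[mu]_x (f x)%:E = (L f)%:E)%E.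
  move=> bf; apply/eqP; rewrite eq_le int_le//=.
  have [mf [K fK]] := bf; have f0 x : 0 <= f x by have /andP[] := fK x.
  have bg : nnbounded (fun x => `|K| - f x).
    split; first exact: measurable_funB.
    exists `|K| => x; rewrite lerBlDr lerDl f0 subr_ge0 andbT.
    by have /andP[_ /le_trans->//] := fK x; exact: ler_norm.
  have LK : L f + L (fun x => `|K| - f x) = `|K| * L \1_setT.
    rewrite -functionalD// -[RHS]addr0 -[X in _ = _ + X]functional0 -LDZ//.
    - by congr L; apply/funext => x; rewrite indicT/= mulr1 addr0 addrC subrK.
    - exact: nnbounded_indic.
    - exact: nnbounded_cst.
  have : (\int[mu]_x (f x)%:E + \int[mu]_x (`|K| - f x)%:E =
      (`|K| * L \1_setT)%:E)%E.
    rewrite -ge0_integralD//=; last 4 first.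
    - by move=> x _; rewrite lee_fin.
    - exact/measurable_EFinP.
    - by move=> x _; rewrite lee_fin; have [_ [M /(_ x)/andP[]]] := bg.
    - exact/measurable_EFinP/bg.1.
    rewrite EFinM -muE// -integral_cst//; apply: eq_integral => x _ /=.
    by rewrite -EFinD addrC subrK.
  rewrite -LK; have := int_le _ bg; have := int_le _ bf.
  have := integral_ge0 mu (D := setT) (f := fun x => (`|K| - f x)%:E).
  have := integral_ge0 mu (D := setT) (f := fun x => (f x)%:E).
  move: (\int[mu]_x (f x)%:E)%E (\int[mu]_x (`|K| - f x)%:E)%E => [u||] [v||]//.
  by rewrite !lee_fin => _ _ ? ? [?]; lra.
exists (fine \o Radon_Nikodym_SigmaFinite.f mu m); split.
- apply: measurableT_comp => //.
  exact: measurable_int (Radon_Nikodym_SigmaFinite.f_integrable mum).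
- by move=> x /=; rewrite fine_ge0// Radon_Nikodym_SigmaFinite.f_ge0.
- apply: eq_integrable (Radon_Nikodym_SigmaFinite.f_integrable mum) => //.
  by move=> x _ /=; rewrite fineK// Radon_Nikodym_SigmaFinite.f_fin_num.
- move=> f bf; have [mf [K fK]] := bf; rewrite -int_eq//.
  rewrite -(Radon_Nikodym_SigmaFinite.change_of_variables mum)//.
  + apply: eq_integral => x _; rewrite EFinM fineK//.
    exact: Radon_Nikodym_SigmaFinite.f_fin_num.
  + by move=> x; rewrite lee_fin; have /andP[] := fK x.
  + exact/measurable_EFinP.
Qed.

End functional_density.

(** * L^p over a finite measure *)

Section Lp_finite_measure.
Context d (T : measurableType d) (R : realType).
Variables (m : {finite_measure set T -> \bar R}) (p : R).
Hypothesis p1 : 1 <= p.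
Implicit Types f g : T -> R.

Let p0 : 0 < p. Proof. exact: lt_le_trans p1. Qed.

Lemma Lnorm_fineK f : inLp m p f -> (normp m p f)%:E = Lnorm m p%:E (EFin \o f).
Proof. by move=> [_ fp]; rewrite fineK// ge0_fin_numE// Lnorm_ge0. Qed.

Lemma normp_ge0 f : 0 <= normp m p f.
Proof. by apply: fine_ge0; exact: Lnorm_ge0. Qed.

Lemma inLpDZ (a : R) f g : inLp m p f -> inLp m p g ->
  inLp m p (fun x => a * f x + g x).
Proof.
have p1E : (1 <= p%:E)%E by rewrite lee_fin.
have inLpE h : inLp m p h <-> h \in Lfun m p%:E.
  split=> [[mh hp]|]; first by rewrite inE; apply/andP; split; rewrite inE.
  by rewrite inE => /andP[]; rewrite !inE.
move=> /inLpE fL /inLpE gL; apply/inLpE.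
by have [_ LfunDZ] := Lfun_submod_closed m p1E; exact: (LfunDZ a f g).
Qed.

Lemma inLp_bounded f (K : R) :
  measurable_fun setT f -> (forall x, `|f x| <= K) -> inLp m p f.
Proof.
move=> mf fK; split => //; rewrite unlock poweR_lty//.
apply: (@le_lt_trans _ _ (\int[m]_x (cst (`|K| `^ p)%:E x))%E).
  apply: ge0_le_integral => //=.
  - apply/measurable_EFinP/(measurableT_comp (measurable_powR _)).
    exact: measurableT_comp.
  - move=> x _; rewrite lee_fin ge0_ler_powR ?nnegrE ?(ltW p0)//.
    by rewrite (le_trans (fK x))// ler_norm.
by rewrite integral_cst//= ltey_eq fin_numM// fin_num_measure.
Qed.

Lemma inLp_nnbounded f : nnbounded f -> inLp m p f.
Proof.
move=> [mf [K fK]]; apply: (inLp_bounded (K := K)) => // x.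
by have /andP[f0 fx] := fK x; rewrite ger0_norm.
Qed.

Lemma inLp_cst (c : R) : inLp m p (cst c).
Proof.
apply: (inLp_bounded (K := `|c|)); first exact: measurable_cst.
by move=> x; exact: lexx.
Qed.

(** Hoelder's inequality for [f] and the constant 1, whose norm for the conjugate exponent is
    [m setT] to the power [1 - p^-1]. *)
Lemma integral_norm_le_normp f : inLp m p f ->
  (\int[m]_x `|f x|%:E <= (normp m p f * fine (m setT) `^ (1 - p^-1))%:E)%E.
Proof.
move=> fL; have [mf _] := fL.
(* For [p = 1] the conjugate exponent is infinite, but the factor is a zeroth power and the bound is
   an equality. *)
have [p_eq1|p_neq1] := eqVneq p 1.
  rewrite EFinM Lnorm_fineK// p_eq1 invr1 subrr powRr0 mule1 Lnorm1.
  exact: lexx.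
have q0 : 0 < 1 - p^-1.
  by rewrite subr_gt0 invf_lt1// lt_neqAle eq_sym p_neq1.
have q1 : p^-1 + (1 - p^-1)^-1^-1 = 1 by rewrite invrK addrC subrK.
have := @hoelder _ _ _ m f (cst 1) p (1 - p^-1)^-1 mf (measurable_cst _) p0.
rewrite invr_gt0 => /(_ q0 q1); rewrite Lnorm1.
under eq_integral do rewrite /= mulr1.
move/le_trans; apply; rewrite EFinM Lnorm_fineK// lee_wpmul2l ?Lnorm_ge0//.
rewrite [Lnorm m _ _ in leLHS](_ : _ = (m setT `^ (1 - p^-1))%E); last first.
  by have := @Lnorm_cst1 _ _ _ m (1 - p^-1)^-1; rewrite invrK.
by rewrite -[m _]fineK ?fin_num_measure//= poweR_EFin.
Qed.

Lemma inLp_integrable f : inLp m p f -> m.-integrable setT (EFin \o f).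
Proof.
move=> fL; apply/integrableP; split.
  by apply/measurable_EFinP; exact: fL.1.
exact: le_lt_trans (integral_norm_le_normp fL) (ltry _).
Qed.

Lemma normp_indic A : measurable A -> normp m p \1_A = fine (m A) `^ p^-1.
Proof.
move=> mA; rewrite /normp unlock.
rewrite (eq_integral (fun x => (\1_A x)%:E)) => [|x _]; last first.
  rewrite /= indicE; case: (_ \in _); first by rewrite normr1 powR1.
  by rewrite normr0 powR0 ?gt_eqF.
by rewrite integral_indic// setIT -[X in fine (X `^ _)%E]fineK ?fin_num_measure.
Qed.

End Lp_finite_measure.

(** * Integrability of a density from a bound on its functional *)

Section dual_bound.
Context d (T : measurableType d) (R : realType).
Variables (m : {finite_measure set T -> \bar R}).

(** Write [x] as the product of its powers [p^-1] and [q^-1], cancel the first, and raise to the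
    power [q]. The absolute value covers a [C] of unknown sign. *)
Lemma le_powR_conjugate (p q C x : R) : 0 < q -> p^-1 + q^-1 = 1 ->
  0 <= x -> x <= C * x `^ p^-1 -> x <= `|C| `^ q.
Proof.
move=> q0 pq x0; have [->|xneq0] := eqVneq x 0; first by rewrite powR_ge0.
have xgt0 : 0 < x by rewrite lt_neqAle eq_sym xneq0.
rewrite -{1}(powRr1 x0) -{1}pq powRD; last by rewrite xneq0 implybT.
rewrite mulrC ler_pM2r ?powR_gt0// => xC.
rewrite -(powRr1 x0) -[X in x `^ X](mulVf (lt0r_neq0 q0)) powRrM.
by rewrite ge0_ler_powR ?nnegrE ?powR_ge0 ?(ltW q0)// (le_trans xC)// ler_norm.
Qed.

(* The test function is [min(rho, n)^(q-1)], the extremal of Hoelder's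
   inequality for the truncation [min(rho, n)]. *)
Lemma dual_bound_inLp (p q C : R) (rho : T -> R) : 1 < p -> p^-1 + q^-1 = 1 ->
  measurable_fun setT rho -> (forall x, 0 <= rho x) ->
  (forall f, nnbounded f ->
    (\int[m]_x (f x * rho x)%:E <= (C * normp m p f)%:E)%E) ->
  inLp m q rho.
Proof.
move=> p1 pq mrho rho0 rhoC.
have p0 : 0 < p by rewrite (lt_trans _ p1).
have qV : q^-1 = 1 - p^-1 by rewrite -pq addrC addKr.
have q0 : 0 < q by rewrite -invr_gt0 qV subr_gt0 invf_lt1.
have q1 : 0 <= q - 1.
  rewrite subr_ge0 -[q]invrK qV invf_ge1 ?gerBl ?invr_ge0 ?(ltW p0)//.
  by rewrite subr_gt0 invf_lt1.
have qp : (q - 1) * p = q.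
  have p_neq0 := lt0r_neq0 p0; have q_neq0 := lt0r_neq0 q0.
  have : p * q * (p^-1 + q^-1) = p * q by rewrite pq mulr1.
  rewrite mulrDr mulrAC divff// mul1r -mulrA divff// mulr1 => e.
  by rewrite mulrBl mul1r mulrC -e addrK.
pose r (n : nat) x := Num.min (rho x) n%:R.
have r0 n x : 0 <= r n x by rewrite le_min rho0/=.
have mr n : measurable_fun setT (r n) by exact: measurable_minr.
have mrX n (s : R) : measurable_fun setT (fun x => r n x `^ s).
  exact: (measurableT_comp (measurable_powR s)).
have brX n (s : R) : 0 <= s -> nnbounded (fun x => r n x `^ s).
  move=> s0; split => //; exists (n%:R `^ s) => x.
  by rewrite powR_ge0/= ge0_ler_powR// ?nnegrE// ge_min lexx orbT.
have rC n : (\int[m]_x (r n x `^ q)%:E <= (`|C| `^ q)%:E)%E.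
  have irq := inLp_integrable (ltW p1)
    (inLp_nnbounded m (ltW p1) (brX n q (ltW q0))).
  set I := (\int[m]_x _)%E.
  have Ifin : I \is a fin_num by exact: integrable_fin_num.
  have nI : normp m p (fun x => r n x `^ (q - 1)) = fine I `^ p^-1.
    rewrite /normp unlock (eq_integral (fun x => (r n x `^ q)%:E)); last first.
      by move=> x _; rewrite /= ger0_norm ?powR_ge0// -powRrM qp.
    by rewrite -/I -[X in fine (X `^ _)%E]fineK.
  rewrite -[I]fineK// lee_fin; apply: (le_powR_conjugate q0 pq).
    by rewrite fine_ge0// integral_ge0// => x _; rewrite lee_fin powR_ge0.
  rewrite -nI -lee_fin fineK//.
  apply: le_trans (rhoC _ (brX n _ q1)); apply: ge0_le_integral => //.
  - by move=> x _; rewrite lee_fin powR_ge0.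
  - exact/measurable_EFinP.
  - by apply/measurable_EFinP; exact: measurable_funM.
  - move=> x _; rewrite lee_fin.
    have -> : r n x `^ q = r n x `^ (q - 1) * r n x.
      have [->|rx] := eqVneq (r n x) 0.
        by rewrite mulr0 powR0// lt0r_neq0.
      rewrite -[X in _ * X]powRr1// -powRD ?subrK//.
      by rewrite rx implybT.
    by rewrite ler_wpM2l ?powR_ge0// ge_min lexx.
split => //; rewrite unlock poweR_lty//.
(* At each [x] the truncations are stationary once [n] exceeds [rho x]; monotone convergence then
   carries the uniform bound over to [rho]. *)
rewrite (eq_integral (fun x => limn (fun n => (r n x `^ q)%:E))); last first.
  move=> x _; apply/esym/cvg_lim => //; apply: cvg_near_cst.
  exists (Num.truncn (rho x)).+1 => // n /= xn.
  rewrite /r min_l ?ger0_norm// (le_trans (ltW (truncnS_gt _)))// ler_nat.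
  exact: xn.
have nd x : {homo (fun n => (r n x `^ q)%:E) : a b / (a <= b)%N >-> (a <= b)%E}.
  move=> a b ab; rewrite lee_fin ge0_ler_powR ?nnegrE ?(ltW q0)//.
  by rewrite le_min !ge_min lexx/= ler_nat ab orbT.
apply: (@le_lt_trans _ _ (`|C| `^ q)%:E); last exact: ltry.
rewrite monotone_convergence//.
- apply: lime_le; last by apply: nearW => n; exact: rC.
  apply: ereal_nondecreasing_is_cvgn => a b ab; apply: ge0_le_integral => //.
  + by move=> x _; rewrite lee_fin powR_ge0.
  + exact/measurable_EFinP.
  + exact/measurable_EFinP.
  + by move=> x _; exact: nd.
- by move=> n; exact/measurable_EFinP.
- by move=> n x _; rewrite lee_fin powR_ge0.
Qed.

End dual_bound.

(** * Markovian semigroups *)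

Section markov_semigroup.
Context d (T : measurableType d) (R : realType).
Variables (m : {finite_measure set T -> \bar R}) (p : R) (P Ra : R -> op T R).
Hypothesis p1 : 1 <= p.
Hypothesis C0P : C0_markov_semigroup m p P.
Implicit Types f g : T -> R.

(** Integrating the orbit over the space reduces the resolvent, an integral with values in L^p, to a
    scalar Abel mean. *)
Definition mean_orbit f t := \int[m]_x P t f x.

Let markovP t : 0 <= t -> markovian_Lp m p (P t).
Proof. by case: C0P => + _ _ _; exact. Qed.

Lemma inLp_semigroup t f : 0 <= t -> inLp m p f -> inLp m p (P t f).
Proof. by move=> /markovP[+ _]; exact. Qed.

Lemma measurable_semigroup t f : 0 <= t -> inLp m p f ->
  measurable_fun setT (P t f).
Proof. by move=> t0 /(inLp_semigroup t0)[]. Qed.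

Lemma integrable_semigroup t f : 0 <= t -> inLp m p f ->
  m.-integrable setT (EFin \o P t f).
Proof. by move=> t0 /(inLp_semigroup t0)/(inLp_integrable p1). Qed.

Lemma ae_eq_Rintegral f g : measurable_fun setT f -> measurable_fun setT g ->
  {ae m, forall x, f x = g x} -> \int[m]_x f x = \int[m]_x g x.
Proof.
move=> mf mg fg; congr fine; apply: ae_eq_integral => //.
- exact/measurable_EFinP.
- exact/measurable_EFinP.
- by apply: filterS fg => x -> _.
Qed.

(** The positive part of [f] is nonnegative everywhere and agrees with [f] almost everywhere. *)
Lemma ae_ge0_Rintegral f : measurable_fun setT f ->
  {ae m, forall x, 0 <= f x} -> 0 <= \int[m]_x f x.
Proof.
move=> mf f0; rewrite (_ : \int[m]_x f x = \int[m]_x Num.max (f x) 0).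
  by apply: Rintegral_ge0 => x _; rewrite le_max lexx orbT.
apply: ae_eq_Rintegral => //; first exact: measurable_maxr.
by apply: filterS f0 => x f0; rewrite max_l.
Qed.

Lemma mean_orbitDZ t (a : R) f g : 0 <= t -> inLp m p f -> inLp m p g ->
  mean_orbit (fun x => a * f x + g x) t = a * mean_orbit f t + mean_orbit g t.
Proof.
move=> t0 fL gL; have [_ [_ lin _ _ _]] := markovP t0.
have iPf := integrable_semigroup t0 fL; have iPg := integrable_semigroup t0 gL.
have mPf := measurable_semigroup t0 fL; have mPg := measurable_semigroup t0 gL.
rewrite /mean_orbit (ae_eq_Rintegral _ _ (lin a f g fL gL)).
- rewrite RintegralD ?RintegralZl//.
  exact: (integrableZl _ a iPf).
- by apply: measurable_semigroup => //; exact: inLpDZ.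
- by apply: measurable_funD => //; exact: measurable_funM.
Qed.

(** Linearity is available only almost everywhere and in the form [a * f + g]: it first gives
    [P t 0 = 0], from [0 = 1 * 0 + 0], and then the claim from [c = c * 1 + 0]. *)
Lemma semigroup_cst t (c : R) : 0 <= t -> {ae m, forall x, P t (cst c) x = c}.
Proof.
have cL (a : R) : inLp m p (cst a) by exact: inLp_cst.
move=> t0; have [_ [_ lin _ P1 _]] := markovP t0.
have lin0 := lin 1 _ _ (cL 0) (cL 0); have linc := lin c _ _ (cL 1) (cL 0).
have E0 : (fun y => 1 * cst 0 y + cst 0 y) = cst 0 :> (T -> R).
  by apply/funext => x /=; rewrite mulr0 addr0.
have Ec : (fun y => c * cst 1 y + cst 0 y) = cst c :> (T -> R).
  by apply/funext => x /=; rewrite mulr1 addr0.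
rewrite E0 in lin0; rewrite Ec in linc.
apply: filterS3 lin0 linc P1 => x P0x -> ->.
by rewrite mulr1 (_ : P t (cst 0) x = 0) ?addr0//; lra.
Qed.

(** Positivity applied to [f - a] and [b - f], since [P t] fixes constants. *)
Lemma semigroup_bounds t f (a b : R) : 0 <= t -> measurable_fun setT f ->
  (forall x, a <= f x <= b) -> {ae m, forall x, a <= P t f x <= b}.
Proof.
move=> t0 mf fab; have [_ [_ lin pos _ _]] := markovP t0.
have cL (c : R) : inLp m p (cst c) by exact: inLp_cst.
have fL : inLp m p f.
  apply: (inLp_bounded m p1 (K := `|a| + `|b|)) => // x.
  have /andP[fa fb] := fab x; rewrite ler_norml lerNl.
  have := ler_norm b; have := ler_norm (- a); rewrite normrN.
  by have := normr_ge0 a; have := normr_ge0 b; lra.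
have lowL := inLpDZ p1 (-1) (cL a) fL; have uppL := inLpDZ p1 (-1) fL (cL b).
have low : {ae m, forall x, 0 <= P t (fun y => -1 * cst a y + f y) x}.
  by apply: pos => //; apply: nearW => x /=; have /andP[] := fab x; lra.
have upp : {ae m, forall x, 0 <= P t (fun y => -1 * f y + cst b y) x}.
  by apply: pos => //; apply: nearW => x /=; have /andP[] := fab x; lra.
have {}low : {ae m, forall x, a <= P t f x}.
  apply: filterS3 low (lin (-1) _ _ (cL a) fL) (semigroup_cst a t0) => x.
  by move=> + E Pa; rewrite E Pa; lra.
have {}upp : {ae m, forall x, P t f x <= b}.
  apply: filterS3 upp (lin (-1) _ _ fL (cL b)) (semigroup_cst b t0) => x.
  by move=> + E Pb; rewrite E Pb; lra.
by apply: filterS2 low upp => x -> ->.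
Qed.

Lemma mean_orbit_cst t (c : R) : 0 <= t ->
  mean_orbit (cst c) t = c * fine (m setT).
Proof.
move=> t0; rewrite -[RHS](Rintegral_cst m measurableT) /mean_orbit.
apply: ae_eq_Rintegral => //; last exact: semigroup_cst.
by apply: measurable_semigroup => //; exact: inLp_cst.
Qed.

Lemma mean_orbit_ge0 t f : 0 <= t -> inLp m p f -> {ae m, forall x, 0 <= f x} ->
  0 <= mean_orbit f t.
Proof.
move=> t0 fL f0; have [_ [_ _ pos _ _]] := markovP t0.
by apply: ae_ge0_Rintegral; [exact: measurable_semigroup|exact: pos].
Qed.

Lemma ae_eq_mean_orbit t f g : 0 <= t -> inLp m p f -> inLp m p g ->
  {ae m, forall x, f x = g x} -> mean_orbit f t = mean_orbit g t.
Proof.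
move=> t0 fL gL fg; have [_ [ext _ _ _ _]] := markovP t0.
by apply: ae_eq_Rintegral; [exact: measurable_semigroup..|exact: ext].
Qed.

Lemma mean_orbit_semigroup s t f : 0 <= s -> 0 <= t -> inLp m p f ->
  mean_orbit (P s f) t = mean_orbit f (t + s).
Proof.
move=> s0 t0 fL; have [_ _ add _] := C0P.
apply: ae_eq_Rintegral.
- by apply: measurable_semigroup => //; exact: inLp_semigroup.
- by apply: measurable_semigroup => //; exact: addr_ge0.
- by apply: filterS (add t s f t0 s0 fL) => x ->.
Qed.

Lemma mean_orbit_bounds t f (K : R) : 0 <= t -> measurable_fun setT f ->
  (forall x, 0 <= f x <= K) -> 0 <= mean_orbit f t <= K * fine (m setT).
Proof.
move=> t0 mf fK; have fL : inLp m p f.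
  by apply: inLp_nnbounded => //; split=> //; exists K.
rewrite mean_orbit_ge0//=; last by apply: nearW => x; have /andP[] := fK x.
rewrite -(mean_orbit_cst K t0) -subr_ge0.
have -> : mean_orbit (cst K) t - mean_orbit f t =
    mean_orbit (fun x => -1 * f x + cst K x) t.
  by rewrite mean_orbitDZ ?mulN1r 1?addrC//; exact: inLp_cst.
apply: mean_orbit_ge0 => //; first by apply: inLpDZ => //; exact: inLp_cst.
by apply: nearW => x /=; rewrite mulN1r addrC subr_ge0; have /andP[] := fK x.
Qed.

(** By the semigroup law the increment over [h] is the mean of [P t (P h f - f)]. Hoelder's
    inequality and boundedness of [P t] control it by the norm of [P h f - f], which tends to 0 by
    strong continuity at 0. *)
Lemma mean_orbit_right_continuous t f : 0 <= t -> inLp m p f ->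
  mean_orbit f x @[x --> t^'+] --> mean_orbit f t.
Proof.
move=> t0 fL; have [_ _ _ cont] := C0P.
have [_ [_ _ _ _ [C PC]]] := markovP t0.
pose D := fine (m setT) `^ (1 - p^-1).
have bound h : 0 <= h -> `|mean_orbit f (t + h) - mean_orbit f t| <=
    `|C| * D * normp m p (fun x => P h f x - f x).
  move=> h0.
  have gL : inLp m p (fun x => -1 * f x + P h f x).
    by apply: inLpDZ => //; exact: inLp_semigroup.
  have -> : mean_orbit f (t + h) - mean_orbit f t =
      mean_orbit (fun x => -1 * f x + P h f x) t.
    rewrite mean_orbitDZ ?mean_orbit_semigroup ?mulN1r 1?addrC//.
    exact: inLp_semigroup.
  have -> : normp m p (fun x => P h f x - f x) =
      normp m p (fun x => -1 * f x + P h f x).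
    by congr normp; apply/funext => x; rewrite mulN1r addrC.
  have iP := integrable_semigroup t0 gL.
  rewrite (le_trans (le_normr_Rintegral measurableT iP))// -lee_fin.
  rewrite fineK; last first.
    by rewrite ge0_fin_numE ?integral_ge0//; have /integrableP[] := iP.
  apply: le_trans (integral_norm_le_normp p1 (inLp_semigroup t0 gL)) _.
  rewrite lee_fin mulrAC ler_wpM2r ?powR_ge0// (le_trans (PC _ gL))//.
  by rewrite ler_wpM2r ?normp_ge0// ler_norm.
have : `|C| * D * normp m p (fun x => P h f x - f x) @[h --> 0^'+] -->
    `|C| * D * 0.
  by apply: cvgMr; exact: cont.
rewrite mulr0 => cvg0; apply/cvgrPdist_lt => e e0.
move/cvgrPdist_lt : cvg0 => /(_ _ e0)[r /= r0 rP]; exists r => //= x.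
rewrite /ball_/= => xr tx.
have xt0 : 0 < x - t by rewrite subr_gt0.
have /= := rP (x - t); rewrite !sub0r !normrN distrC in xr *.
move=> /(_ xr xt0); apply: le_lt_trans.
have := bound _ (ltW xt0); rewrite addrCA subrr addr0 distrC.
by move=> /le_trans; apply; exact: ler_norm.
Qed.

Lemma measurable_mean_orbit f : inLp m p f ->
  measurable_fun `[(0 : R), +oo[ (mean_orbit f).
Proof.
move=> fL; apply: right_continuous_measurable_fun => t t0.
exact: mean_orbit_right_continuous.
Qed.

Hypothesis RaP : is_resolvent m p P Ra.

(** The duality that characterizes the resolvent, tested on the constant 1. *)
Lemma resolvent_abel a f : 0 < a -> nnbounded f ->
  (\int[m]_x (a * Ra a f x)%:E = (abel a (mean_orbit f))%:E)%E.
Proof.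
move=> a0 bf; have fL := inLp_nnbounded m p1 bf.
have [RL _ /(_ (cst 1))] := RaP a0 fL.
have b1 : bounded_meas (cst 1 : T -> R).
  by split => //; exists 1 => x; rewrite normr1.
move=> /(_ b1); under eq_integral do rewrite mul1r.
move=> RE.
have iR := inLp_integrable p1 RL.
have mo := measurable_mean_orbit fL.
under eq_integral do rewrite EFinM.
rewrite integralZl// RE.
have [mf [K fK]] := bf.
transitivity (\int[lebesgue_measure]_(t in `[0%R, +oo[)
   (a * expR (- (a * t)) * mean_orbit f t)%:E)%E.
  have oE t : fine (\int[m]_x (cst 1 x * P t f x)%:E) = mean_orbit f t.
    by congr fine; apply: eq_integral => x _; rewrite mul1r.
  under eq_integral do rewrite oE.
  rewrite -ge0_integralZl ?lee_fin ?(ltW a0)//.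
  - by apply: eq_integral => t _; rewrite -EFinM mulrA.
  - apply/measurable_EFinP; apply: measurable_funM => //.
    apply: measurable_funTS; apply: measurableT_comp => //.
    by apply: measurableT_comp => //; exact: measurable_funM.
  - move=> t /=; rewrite in_itv/= andbT => t0.
    rewrite lee_fin mulr_ge0 ?expR_ge0//.
    by have /andP[] := mean_orbit_bounds t0 mf fK.
rewrite fineK//.
apply: integrable_fin_num => //.
refine (abel_integrable (K := K * fine (m setT)) a0 mo _) => t t0.
by have /andP[u0 uK] := mean_orbit_bounds t0 mf fK; rewrite ger0_norm.
Qed.

End markov_semigroup.

(** * The limit functional and its invariant density *)

Section abel_limit.
Context d (T : measurableType d) (R : realType).
Variables (m : {finite_measure set T -> \bar R}) (p M : R) (P Ra : R -> op T R).
Hypothesis p1 : 1 <= p.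
Hypothesis C0P : C0_markov_semigroup m p P.
Hypothesis RaP : is_resolvent m p P Ra.
Hypothesis RaM : forall a, 0 < a -> forall f, inLp m p f ->
  normp m p (fun x => a * Ra a f x) <= M * normp m p f.
Implicit Types f g h : T -> R.

(** The operator bound times the Hoelder constant. The absolute value makes [C] nonnegative, as [M]
    may be any real number. *)
Let C := `|M| * fine (m setT) `^ (1 - p^-1).

Lemma resolvent_bound a f : 0 < a -> inLp m p f ->
  (\int[m]_x (a * Ra a f x)%:E <= (C * normp m p f)%:E)%E.
Proof.
move=> a0 fL; have [RL _ _] := RaP a0 fL.
have aRL : inLp m p (fun x => a * Ra a f x).
  rewrite (_ : (fun _ => _) = fun x => a * Ra a f x + cst 0 x).
    by apply: inLpDZ => //; exact: inLp_cst.
  by apply/funext => x; rewrite addr0.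
have iR := inLp_integrable p1 aRL.
apply: (@le_trans _ _ (\int[m]_x `|a * Ra a f x|%:E)%E).
  apply: le_integral => //; first exact: integrable_abse iR.
  by move=> x _; rewrite lee_fin ler_norm.
apply: (le_trans (integral_norm_le_normp p1 aRL)).
rewrite lee_fin /C mulrAC ler_wpM2r ?powR_ge0// (le_trans (RaM a0 fL))//.
by rewrite ler_wpM2r ?normp_ge0// ler_norm.
Qed.

Lemma abel_bound a f : 0 < a -> nnbounded f ->
  abel a (mean_orbit m P f) <= C * normp m p f.
Proof.
move=> a0 bf; rewrite -lee_fin -(resolvent_abel p1 C0P RaP)//.
by apply: resolvent_bound => //; exact: inLp_nnbounded.
Qed.

Let C_ge0 : 0 <= C.
Proof. by rewrite mulr_ge0 ?powR_ge0. Qed.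

Lemma normp_indic_small (e : R) : 0 < e -> exists eta : R, 0 < eta /\
  forall A, measurable A -> (m A < eta%:E)%E -> C * normp m p \1_A < e.
Proof.
move=> e0; have p0 : 0 < p by exact: lt_le_trans p1.
(* Dividing by [C + 1] rather than [C] covers the case [C = 0]; the power [p] below undoes the
   [p^-1] of [normp_indic]. *)
have eC : 0 < e / (C + 1) by rewrite divr_gt0// ltr_wpDl ?C_ge0.
exists ((e / (C + 1)) `^ p); split; first exact: powR_gt0.
move=> A mA mAe; rewrite normp_indic//.
have mA' : fine (m A) < (e / (C + 1)) `^ p.
  by rewrite -lte_fin fineK ?fin_num_measure.
have : fine (m A) `^ p^-1 < e / (C + 1).
  rewrite -[ltRHS]powRr1 ?(ltW eC)//.
  rewrite -[X in _ < _ `^ X](divff (lt0r_neq0 p0)) powRrM.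
  by rewrite gt0_ltr_powR ?invr_gt0// nnegrE ?powR_ge0 ?fine_ge0.
rewrite ltr_pdivlMr ?ltr_wpDl ?C_ge0//; apply: le_lt_trans.
by rewrite mulrC ler_wpM2l ?powR_ge0// lerDl.
Qed.

Lemma resolvent_almost_invariant_bounded : resolvent_almost_invariant m Ra.
Proof.
exists 0, (fun A => C * normp m p \1_A); split => //.
- by move=> A; rewrite mulr_ge0 ?C_ge0 ?normp_ge0.
- exact: normp_indic_small.
- move=> A mA a a0; rewrite mul0e adde0; apply: resolvent_bound => //.
  exact/(inLp_nnbounded m p1)/nnbounded_indic.
Qed.

Variable U : set_system R.
Hypothesis ultraU : UltraFilter U.
Hypothesis sU : 0^'+ `<=` U.

Let near0U : \forall a \near U, 0 < a.
Proof. by apply: sU; exact: nbhs_right_gt. Qed.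

(** Along an ultrafilter all bounded families converge, which keeps this limit linear where an upper
    limit would only be sublinear. *)
Definition abel_lim f : R := lim (abel a (mean_orbit m P f) @[a --> U]).

Lemma cvg_abel_lim f : nnbounded f ->
  abel a (mean_orbit m P f) @[a --> U] --> abel_lim f.
Proof.
move=> bf; have [mf [K fK]] := bf.
apply: (ultra_bounded_cvg (a := 0) (b := K * fine (m setT))).
apply: filterS near0U => a a0.
have oK t : 0 <= t -> 0 <= mean_orbit m P f t <= K * fine (m setT).
  by move=> t0; exact: (mean_orbit_bounds p1 C0P t0 mf fK).
rewrite abel_ge0//=; last by move=> t /oK/andP[].
apply: abel_le => //; apply: (measurable_mean_orbit p1 C0P).
exact: inLp_nnbounded.
Qed.

Lemma abel_limDZ (c : R) f g : 0 <= c -> nnbounded f -> nnbounded g ->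
  abel_lim (fun x => c * f x + g x) = c * abel_lim f + abel_lim g.
Proof.
move=> c0 bf bg; apply: cvg_lim => //.
have [mf [K fK]] := bf; have [mg [K' gK]] := bg.
have cvgfg : c * abel a (mean_orbit m P f) + abel a (mean_orbit m P g)
    @[a --> U] --> c * abel_lim f + abel_lim g.
  by apply: cvgD; [apply: cvgM; [exact: cvg_cst|]|]; exact: cvg_abel_lim.
(* The Abel means are additive for [a > 0], hence eventually along [U]. *)
move=> A /cvgfg; apply: filterS2 near0U => a a0 /=.
rewrite (_ : abel a (mean_orbit m P (fun x => c * f x + g x)) =
  c * abel a (mean_orbit m P f) + abel a (mean_orbit m P g))//.
have nb h L : (forall x, 0 <= h x <= L) -> measurable_fun setT h ->
    forall t, 0 <= t -> `|mean_orbit m P h t| <= L * fine (m setT).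
  move=> hL mh t t0; have /andP[u0 uK] := mean_orbit_bounds p1 C0P t0 mh hL.
  by rewrite ger0_norm.
rewrite -(abelDZ c a0 _ _ (nb f K fK mf) (nb g K' gK mg)).
- apply: eq_abel => t t0.
  by rewrite (mean_orbitDZ p1 C0P)//; exact: inLp_nnbounded.
- by apply: (measurable_mean_orbit p1 C0P); exact: inLp_nnbounded.
- by apply: (measurable_mean_orbit p1 C0P); exact: inLp_nnbounded.
Qed.

Lemma abel_lim_ge0 f : nnbounded f -> 0 <= abel_lim f.
Proof.
move=> bf; have [mf [K fK]] := bf; apply: limr_ge.
  by apply/cvg_ex; eexists; exact: cvg_abel_lim.
apply: filterS near0U => a a0; apply: abel_ge0 => // t t0.
by have /andP[] := mean_orbit_bounds p1 C0P t0 mf fK.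
Qed.

Lemma abel_lim_le f : nnbounded f -> abel_lim f <= C * normp m p f.
Proof.
move=> bf; apply: limr_le; first by apply/cvg_ex; eexists; exact: cvg_abel_lim.
by apply: filterS near0U => a a0; exact: abel_bound.
Qed.

(** Since [P t 1 = 1], the mass is conserved; this is what makes the density nonzero. *)
Lemma abel_lim1 : abel_lim (cst 1) = fine (m setT).
Proof.
apply: cvg_lim => //; apply: cvg_near_cst; apply: filterS near0U => a a0.
rewrite -[RHS](abel_cst _ a0); apply: eq_abel => t t0.
by rewrite (mean_orbit_cst p1 C0P)// mul1r.
Qed.

(* By [abel_shift] the two Abel means differ by [O(a)] as [a] tends to [0]. *)
Lemma abel_lim_invariant s f g : 0 <= s -> nnbounded f -> nnbounded g ->
  {ae m, forall x, g x = P s f x} -> abel_lim g = abel_lim f.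
Proof.
move=> s0 bf bg gPf; have [mf [K fK]] := bf.
have fL := inLp_nnbounded m p1 bf; have gL := inLp_nnbounded m p1 bg.
(* As [g] represents [P s f], its orbit is the orbit of [f] delayed by [s]. *)
have shift a : 0 < a -> abel a (fun t => mean_orbit m P f (t + s)) =
    abel a (mean_orbit m P g).
  move=> a0; apply: eq_abel => t t0; rewrite -(mean_orbit_semigroup C0P)//.
  apply: (ae_eq_mean_orbit C0P) => //; first exact: (inLp_semigroup C0P).
  by apply: filterS gPf => x ->.
pose K' := K * fine (m setT).
have bounds a : 0 < a ->
    expR (- (a * s)) * abel a (mean_orbit m P g) <= abel a (mean_orbit m P f)
    <= a * K' * s + expR (- (a * s)) * abel a (mean_orbit m P g).
  move=> a0; rewrite -shift//; apply: abel_shift => //.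
    exact: (measurable_mean_orbit p1 C0P).
  by move=> t t0; exact: (mean_orbit_bounds p1 C0P t0 mf fK).
have cvgU (u : R -> R) : continuous u -> u a @[a --> U] --> u 0.
  move=> cu A uA; apply: sU; exact: (cvg_at_right_filter (cu 0)).
have cexp : expR (- (a * s)) @[a --> U] --> (1 : R).
  rewrite -[X in _ --> X](_ : expR (- (0 * s)) = 1); last first.
    by rewrite mul0r oppr0 expR0.
  apply: (cvgU (fun a => expR (- (a * s)))) => a.
  apply: continuous_comp; last exact: continuous_expR.
  by apply: cvgN; apply: cvgM; [exact: cvg_id|exact: cvg_cst].
have clin : a * K' * s @[a --> U] --> (0 : R).
  rewrite -[X in _ --> X](_ : 0 * K' * s = 0); last by rewrite !mul0r.
  apply: (cvgU (fun a => a * K' * s)) => a.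
  by apply: cvgM; [apply: cvgM; [exact: cvg_id|exact: cvg_cst]|exact: cvg_cst].
have cvg_g : expR (- (a * s)) * abel a (mean_orbit m P g) @[a --> U] -->
    abel_lim g.
  by rewrite -[abel_lim g]mul1r; apply: cvgM => //; exact: cvg_abel_lim.
have cvg_g' : a * K' * s + expR (- (a * s)) * abel a (mean_orbit m P g)
    @[a --> U] --> abel_lim g.
  by rewrite -[abel_lim g]add0r; exact: cvgD.
(* Squeeze: both bounds on the Abel mean of [f] converge to [abel_lim g]. *)
apply/eqP; rewrite eq_le; apply/andP; split.
- apply: (ler_cvg_to cvg_g (cvg_abel_lim bf)).
  by apply: filterS near0U => a /bounds/andP[].
- apply: (ler_cvg_to (cvg_abel_lim bf) cvg_g').
  by apply: filterS near0U => a /bounds/andP[].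
Qed.

(** [rho] is the density of [abel_lim], with total mass [m setT]. Invariance, known on the cone,
    extends to a function bounded by [K] by adding the constant [K] and subtracting it again. *)
Lemma invariant_density_exists : (0 < m setT)%E -> exists rho,
  invariant_density m P rho /\
  forall f, nnbounded f ->
    (\int[m]_x (f x * rho x)%:E <= (C * normp m p f)%:E)%E.
Proof.
move=> m0.
have [e e0|rho [mrho rho0 irho rhoE]] :=
    @functional_density _ _ _ m _ abel_limDZ abel_lim_ge0.
  have [eta [eta0 etaP]] := normp_indic_small e0.
  exists eta; split => // A mA mAeta; apply: le_lt_trans (etaP _ mA mAeta).
  exact/abel_lim_le/nnbounded_indic.
exists rho; split; last first.
  by move=> f bf; rewrite rhoE// lee_fin; exact: abel_lim_le.
have int1 : (\int[m]_x (rho x)%:E)%E = (fine (m setT))%:E.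
  rewrite -abel_lim1 -rhoE; last exact: nnbounded_cst.
  by apply: eq_integral => x _; rewrite /= mul1r.
split => //; first by rewrite int1 fineK ?fin_num_measure.
  by rewrite int1 ltry.
move=> t t0 f [mf [K fK]].
have absK x : - K <= f x <= K by rewrite -ler_norml.
have fL : inLp m p f by exact: (inLp_bounded m p1 (K := K)).
have bh : nnbounded (fun x => 1 * f x + cst K x).
  split; first by apply: measurable_funD => //; exact: measurable_funM.
  by exists (K + K) => x /=; have := absK x; lra.
have mPf := measurable_semigroup C0P (ltW t0) fL.
(* [P t f] obeys the bounds of [f] only almost everywhere. Clipping it to [[-K, K]] gives a
   representative of [P t (f + K)] that lies in the cone. *)
pose g x := 1 * Num.max (- K) (Num.min (P t f x) K) + K.
have mg : measurable_fun setT g.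
  apply: measurable_funD => //; apply: measurable_funM => //.
  by apply: measurable_maxr => //; exact: measurable_minr.
have bg : nnbounded g.
  split => //; exists (K + K) => x.
  have K0 : 0 <= K by rewrite (le_trans _ (fK x)).
  rewrite /g mul1r -lerBlDr sub0r le_max lexx/= lerD2r ge_max ge_min lexx.
  by rewrite orbT andbT; lra.
have gP : {ae m, forall x, g x = P t f x + K}.
  apply: filterS (semigroup_bounds p1 C0P (ltW t0) mf absK) => x /andP[lo hi].
  by rewrite /g mul1r min_l// max_r.
have ghP : {ae m, forall x, g x = P t (fun y => 1 * f y + cst K y) x}.
  have [/(_ _ (ltW t0))[_ [_ lin _ _ _]] _ _ _] := C0P.
  have := lin 1 _ _ fL (inLp_cst m p1 K).
  apply: filterS3 gP (semigroup_cst p1 C0P K (ltW t0)) => x -> -> ->.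
  by rewrite mul1r.
(* Subtracting [K] costs [K * fine (m setT)], the same for [f + K] and for [g], so equality of their
   limits suffices. *)
have shift u : nnbounded u -> (\int[m]_x ((u x - K) * rho x)%:E =
    (abel_lim u - K * fine (m setT))%:E)%E.
  move=> bu; have [mu [L uL]] := bu.
  have iu : m.-integrable setT (EFin \o (fun x => u x * rho x)).
    apply/integrableP; split.
      by apply/measurable_EFinP; exact: measurable_funM.
    rewrite (eq_integral (fun x => (u x * rho x)%:E)) ?rhoE ?ltry// => x _.
    by rewrite /= ger0_norm// mulr_ge0//; have /andP[] := uL x.
  under eq_integral do rewrite mulrBl EFinB.
  rewrite integralB//; last exact: (integrableZl _ K irho).
  under [X in (_ - X)%E]eq_integral do rewrite EFinM.
  by rewrite integralZl// rhoE// int1 -EFinM -EFinB.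
transitivity (\int[m]_x ((g x - K) * rho x)%:E)%E.
  apply: ae_eq_integral => //.
  - by apply/measurable_EFinP; exact: measurable_funM.
  - apply/measurable_EFinP; apply: measurable_funM => //.
    exact: measurable_funB.
  - by apply: filterS gP => x -> _; rewrite addrK.
rewrite shift// (abel_lim_invariant (ltW t0) bh bg ghP) -shift//.
by apply: eq_integral => x _; rewrite /= mul1r addrK.
Qed.

End abel_limit.

Theorem theorem3p20 (d : measure_display) (T : measurableType d) (R : realType)
  (m : {finite_measure set T -> \bar R}) (p : R) (P Ra : R -> op T R) :
  (0 < m setT)%E -> 1 <= p ->
  C0_markov_semigroup m p P ->
  is_resolvent m p P Ra ->
  unif_bounded_resolvent m p Ra ->
  [/\ resolvent_almost_invariant m Ra,
      (exists rho : T -> R, invariant_density m P rho) &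
      (1 < p -> forall q : R, p^-1 + q^-1 = 1 ->
         exists rho : T -> R, invariant_density m P rho /\ inLp m q rho)].
Proof.
move=> m0 p1 C0P RaP [M RaM].
(* One ultrafilter yields one [rho], which serves both existence claims; it does not depend on
   [q]. *)
have [U [ultraU sU]] := ultraFilterLemma (at_right_proper_filter (0 : R)).
have [rho [invrho rhoC]] :=
  invariant_density_exists p1 C0P RaP RaM ultraU sU m0.
split.
- exact: resolvent_almost_invariant_bounded p1 RaP RaM.
- by exists rho.
- move=> p_gt1 q pq; exists rho; split => //.
  have [mrho rho0 _ _ _] := invrho.
  exact: dual_bound_inLp p_gt1 pq mrho rho0 rhoC.
Qed.
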